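(* Let $k\geq 3$ and $N$ be integers and let $G$ be an abelian group with $|G|\geq N^{k-1}$. Then any non-adaptive $(S,T)$ algorithm for $\textsf{kSUM-Indexing}(G,N)$ satisfies $S=\widetilde{\Omega}(N^{1+1/T})$.
   Context: Model: word RAM with words of $\Theta(\log N)$ bits; $G$ is an abelian group with $|G|\leq N^c$ for some constant $c>0$, with an injective encoding $\mathsf{Index}:G\to[N^c]$, so each element fits in a word. An $(S,T)$ algorithm for $\textsf{kSUM-Indexing}(G,N)$ is a pair $(\mathcal{A}_1,\mathcal{A}_2)$: the computationally unbounded $\mathcal{A}_1$ receives a tuple $A=(a_1,\ldots,a_N)\in G^N$ and outputs a data structure $D_A$ of at most $S$ words; for every such $A$ and every query $b\in Z=\{\sum_{i\in I}a_i: I\subseteq[N],|I|=k-1\}$, $\mathcal{A}_2$ makes at most $T$ probes to cells of $D_A$ and outputs $I\subseteq[N]$ with $|I|=k-1$ and $\sum_{i\in I}a_i=b$ (online computation otherwise unbounded). The algorithm is non-adaptive if the set of cells probed by $\mathcal{A}_2$ on query $b$ depends only on $b$. $\widetilde{\Omega}$ hides polylogarithmic factors in $N$. *)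

(* Defs.v *)
From HB Require Import structures.
From mathcomp Require Export all_boot all_order all_algebra.
From mathcomp Require Export reals exp.

Set Implicit Arguments.
Unset Strict Implicit.
Unset Printing Implicit Defensive.

Import Order.TTheory GRing.Theory Num.Theory.
Local Open Scope ring_scope.

Definition word (w : nat) : Type := w.-tuple bool.

(* An (in general adaptive) online algorithm with unbounded computation: each
   node either outputs or probes an address and continues depending on the
   content found there.  The answer is [None] when the address lies outside
   the data structure. *)
Inductive cell_probe (w : nat) (Out : Type) : Type :=
| Output of Out
| Probe of nat & (option (word w) -> cell_probe w Out).

Fixpoint run w Out (p : cell_probe w Out) (D : seq (word w)) : Out :=
  match p with
  | Output o => o
  | Probe i next => run (next (onth D i)) D
  end.

(* The addresses probed, in order and with repetitions. *)
Fixpoint probes w Out (p : cell_probe w Out) (D : seq (word w)) : seq nat :=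
  match p with
  | Output _ => [::]
  | Probe i next => i :: probes (next (onth D i)) D
  end.

Section KSumIndexing.
Variables (G : finZmodType) (N k w : nat).

Definition ksum_queries (A : N.-tuple G) : {set G} :=
  [set \sum_(i in I) tnth A i | I : {set 'I_N} & #|I| == k.-1].

Record indexing_alg := IndexingAlg {
  preprocess : N.-tuple G -> seq (word w);
  answer : G -> cell_probe w {set 'I_N}
}.

Definition solves_ksum_indexing (S T : nat) (alg : indexing_alg) : Prop :=
  forall A : N.-tuple G,
    (size (preprocess alg A) <= S)%N /\
    (forall b : G, b \in ksum_queries A ->
       let D := preprocess alg A in
       let I := run (answer alg b) D in
       [/\ (size (probes (answer alg b) D) <= T)%N,
           #|I| = k.-1 &
           \sum_(i in I) tnth A i = b]).

(* [=i] compares the two probe sequences as sets of addresses. *)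
Definition non_adaptive (alg : indexing_alg) : Prop :=
  forall (A A' : N.-tuple G) (b : G),
    b \in ksum_queries A -> b \in ksum_queries A' ->
    probes (answer alg b) (preprocess alg A)
      =i probes (answer alg b) (preprocess alg A').

End KSumIndexing.

(* An injective encoding of G into {1, ..., floor (N ^ c)}. *)
Definition index_encoding (R : realType) (c : R) (N : nat) (G : finZmodType)
    (index : G -> nat) : Prop :=
  injective index /\
  forall g : G, (0 < index g)%N /\ (index g)%:R <= N%:R `^ c.

(* Words of Theta(log N) bits, with explicit constants u and v. *)
Definition word_length (R : realType) (u v : R) (N w : nat) : Prop :=
  u * ln N%:R <= w%:R <= v * ln N%:R.

(* Main.v *)
(** Let the first [m = N / 8] entries of the input be uniformly random and the
    others zero, and write [s = k - 1].  Cutting the [S] cells into [K] blocks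
    with [K ^ T <= m], the pigeonhole principle yields a set [L] of about
    [T S / K] cells and a set [G'] of about [|G| / 2m] queries whose probes all
    lie in [L].  Call an index [i] hit if some sum [a_i + a_j] lies in [G'] and
    is not a sum of at most [s] entries avoiding [a_i].  A second moment
    computation shows that a constant fraction of the inputs have a constant
    fraction of their indices hit.  The answer to the query [a_i + a_j] must
    contain [i], so it is a linear equation that determines [a_i] from other
    entries; greedily one finds [r] proportional to [m / s] such equations in
    triangular form.  Hence such an input is determined by the content of [L],
    by [r] elements of [G'] with a choice of pivot in each answer, and by the
    other [m - r] entries.  This encoding saves a factor of about [m / s] per
    equation, which forces the content of [L] to have order [N log N] bits. *)

Require Import Defs.
From mathcomp Require Import zify ring lra.

Set Implicit Arguments.
Unset Strict Implicit.
Unset Printing Implicit Defensive.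

Import Order.TTheory GRing.Theory Num.Theory.
Local Open Scope ring_scope.

(* Keeps sums of group elements in [ring_scope] inside [nat_scope] statements. *)
Local Notation psum A i j := (A i + A j)%R.

(** * Triangular systems and hit indices *)

(** A union bound whose ratio [y / x] is kept as two factors, so that all counting stays in
    [nat]. *)
Lemma card_union_bound (I T : finType) (P : {set I}) (F : I -> {set T})
    (X : {set T}) (x y : nat) :
  X \subset \bigcup_(i in P) F i -> {in P, forall i, #|F i| * x <= y}%N ->
  (#|X| * x <= #|P| * y)%N.
Proof.
move=> sub le_F; apply: (@leq_trans ((\sum_(i in P) #|F i|) * x)).
  rewrite leq_mul2r (leq_trans (subset_leq_card sub)) ?orbT //.
  elim/big_rec2: _ => [|i n B _ le_B]; first by rewrite cards0.
  by rewrite (leq_trans (leq_card_setU _ _)) // leq_add2l.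
by rewrite big_distrl /= -sum_nat_const; exact: leq_sum.
Qed.

Section Systems.
Variables (G : finZmodType) (m : nat).
Implicit Types (A : {ffun 'I_m -> G}) (J : {set 'I_m}) (i j : 'I_m) (b : G).

Definition subsum A J : G := \sum_(i in J) A i.

(* A system is a list of triples (pivot, support, right-hand side); each pivot
   occurs in its own equation but in none of those further down the list. *)
Fixpoint triangular (t : seq ('I_m * {set 'I_m} * G)) : bool :=
  if t is e :: t' then
    [&& e.1.1 \in e.1.2,
        all (fun e' : 'I_m * {set 'I_m} * G => e.1.1 \notin e'.1.2) t' &
        triangular t']
  else true.

Definition solutions (t : seq ('I_m * {set 'I_m} * G)) : {set {ffun 'I_m -> G}} :=
  [set A : {ffun 'I_m -> G} |
    all (fun e : 'I_m * {set 'I_m} * G => subsum A e.1.2 == e.2) t].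

Definition shift i (x : G) A : {ffun 'I_m -> G} :=
  [ffun j => if j == i then A j + x else A j].

Lemma subsum_shift i x A J :
  subsum (shift i x A) J = if i \in J then subsum A J + x else subsum A J.
Proof.
rewrite /subsum; case: ifPn => iJ.
  rewrite (bigD1 i iJ) [in RHS](bigD1 i iJ) /= ffunE eqxx -!addrA; congr (_ + _).
  rewrite addrC; congr (_ + _); apply: eq_bigr => j /andP[_ /negbTE ji].
  by rewrite ffunE ji.
by apply: eq_bigr => j jJ; rewrite ffunE; case: eqP => // ji; rewrite ji (negbTE iJ) in jJ.
Qed.

Lemma shift_inj i x : injective (shift i x).
Proof.
move=> A B /ffunP E; apply/ffunP => j; move: (E j); rewrite !ffunE.
by case: ifP => // _ /addIr.
Qed.

(** Adding [x] to the pivot coordinate of a solution changes, among all equations of the list, only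
    the first one, by [x]. So pairs of a solution and an [x] embed into the solutions of the tail,
    and each equation costs a factor [#|G|]. *)
Lemma card_solutions t : triangular t -> (#|solutions t| * #|G| ^ size t <= #|G| ^ m)%N.
Proof.
elim: t => [_|[[i J] b] t IH /= /and3P[iJ /allP iN /IH le_t]].
  by rewrite muln1 (leq_trans (max_card _)) // card_ffun card_ord.
apply: leq_trans le_t; rewrite expnS mulnA leq_mul2r; apply/orP; right.
rewrite -[#|G|]cardsT -cardsX.
pose f (p : {ffun 'I_m -> G} * G) := shift i p.2 p.1.
have f_inj : {in setX (solutions ((i, J, b) :: t)) setT &, injective f}.
  move=> [A x] [B y]; rewrite !inE /= !andbT => /andP[/eqP Ab _] /andP[/eqP Bb _] E.
  have := congr1 (subsum^~ J) E; rewrite /= /f /= !subsum_shift iJ Ab Bb => /addrI xy.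
  by move: E; rewrite /f /= xy => /shift_inj ->.
rewrite -(card_in_imset f_inj); apply/subset_leq_card/subsetP => B /imsetP[[A x]].
rewrite !inE /= andbT => /andP[_ /allP At] ->; apply/allP => e et /=.
by rewrite /f subsum_shift (negbTE (iN e et)); exact: At.
Qed.

Lemma subsum2 A i j : i != j -> subsum A [set i; j] = psum A i j.
Proof. by move=> ij; rewrite /subsum big_setU1 ?inE //= big_set1. Qed.

Lemma card_two_sums i j j' (G' : {set G}) : j != i -> j' != i -> j != j' ->
  (#|[set A : {ffun 'I_m -> G} | (psum A i j \in G') && (psum A i j' \in G')]| * #|G| ^ 2
     <= #|G'| ^ 2 * #|G| ^ m)%N.
Proof.
move=> ji j'i jj'.
pose t (b b' : G) := [:: (j, [set i; j], b); (j', [set i; j'], b')].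
have tri b b' : triangular (t b b').
  by rewrite /= !inE !eqxx ?orbT !andbT /= negb_or ji jj'.
have sub : [set A : {ffun 'I_m -> G} | (psum A i j \in G') && (psum A i j' \in G')]
    \subset \bigcup_(p in setX G' G') solutions (t p.1 p.2).
  apply/subsetP => A; rewrite inE => /andP[h h'].
  apply/bigcupP; exists (psum A i j, psum A i j'); first by rewrite !inE h h'.
  by rewrite inE /= !subsum2 1?eq_sym // !eqxx.
rewrite -(mulnn #|G'|) -cardsX; apply: (card_union_bound sub) => p _.
exact: (card_solutions (tri _ _)).
Qed.

(** The sets [[set i; j]] and [J] give two triangular equations with one common right-hand side, so
    a single choice in [G'] stands against two factors [#|G|]. *)
Lemma card_colliding_sum i j J (G' : {set G}) : j != i -> J != set0 -> i \notin J ->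
  (#|[set A : {ffun 'I_m -> G} | (psum A i j \in G') && (subsum A J == psum A i j)]|
     * #|G| ^ 2
     <= #|G'| * #|G| ^ m)%N.
Proof.
move=> ji /set0Pn[j0 j0J] iJ.
pose t (b : G) := [:: (i, [set i; j], b); (j0, J, b)].
have tri b : triangular (t b) by rewrite /= !inE !eqxx iJ j0J.
have sub : [set A : {ffun 'I_m -> G} | (psum A i j \in G') && (subsum A J == psum A i j)]
    \subset \bigcup_(b in G') solutions (t b).
  apply/subsetP => A; rewrite inE => /andP[h h']; apply/bigcupP.
  by exists (psum A i j); rewrite // inE /= subsum2 ?h' ?eqxx // eq_sym.
apply: (card_union_bound sub) => b _; exact: (card_solutions (tri _)).
Qed.

Lemma card_sum_le i j (G' : {set G}) : j != i ->
  (#|[set A : {ffun 'I_m -> G} | psum A i j \in G']| * #|G| <= #|G'| * #|G| ^ m)%N.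
Proof.
move=> ji; pose t (b : G) := [:: (i, [set i; j], b)].
have tri b : triangular (t b) by rewrite /= !inE !eqxx.
have sub : [set A : {ffun 'I_m -> G} | psum A i j \in G'] \subset \bigcup_(b in G') solutions (t b).
  apply/subsetP => A; rewrite inE => h; apply/bigcupP.
  by exists (psum A i j); rewrite // inE /= subsum2 1?eq_sym // eqxx.
apply: (card_union_bound sub) => b _; exact: (card_solutions (tri _)).
Qed.

(** This is [card_sum_le] for the complement of [G']. *)
Lemma card_sum_ge i j (G' : {set G}) : j != i ->
  (#|G'| * #|G| ^ m <= #|[set A : {ffun 'I_m -> G} | psum A i j \in G']| * #|G|)%N.
Proof.
move=> ji; have := card_sum_le (~: G') ji.
have -> : [set A : {ffun 'I_m -> G} | psum A i j \in ~: G'] =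
    ~: [set A : {ffun 'I_m -> G} | psum A i j \in G'].
  by apply/setP => A; rewrite !inE.
have := cardsC G'; have := cardsC [set A : {ffun 'I_m -> G} | psum A i j \in G'].
rewrite card_ffun card_ord => eX eG le.
have aux (x y a b p g : nat) :
    (x + y = p -> a + b = g -> y * g <= b * p -> a * p <= x * g)%N.
  by move=> <- <-; nia.
exact: aux eX eG le.
Qed.

Lemma card_small_subsets s : (0 < s)%N ->
  (#|[set J : {set 'I_m} | (J != set0) && (#|J| <= s)]| <= m ^ s)%N.
Proof.
move=> s_gt0; pose f (h : {ffun 'I_s -> 'I_m}) := [set h x | x : 'I_s].
have -> : (m ^ s = #|{ffun 'I_s -> 'I_m}|)%N by rewrite card_ffun !card_ord.
apply: leq_trans (leq_imset_card f _); apply/subset_leq_card/subsetP => J.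
rewrite inE => /andP[/set0Pn[j0 j0J] le_J].
(* Enumerations shorter than [s] are padded with [j0], which lies in [J], so the image is still
   [J]. *)
apply/imsetP; exists [ffun x : 'I_s => nth j0 (enum J) x] => //.
apply/setP => j; apply/idP/imsetP => [jJ|[x _ ->]]; last first.
  rewrite ffunE -mem_enum; have [lt|le] := ltnP x (size (enum J)).
    exact: mem_nth.
  by rewrite nth_default // mem_enum.
have lt : (index j (enum J) < s)%N.
  by rewrite (leq_trans _ le_J) // cardE index_mem mem_enum.
by exists (Ordinal lt); rewrite // ffunE /= nth_index // mem_enum.
Qed.

(** * Second moment bound for hit indices *)

Variables (s : nat) (G' : {set G}).

(** The last clause forces [i] into every correct answer of size at most [s] to the query
    [psum A i j]. *)
Definition hit i A := [exists j, [&& j != i, psum A i j \in G' &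
  [forall J : {set 'I_m}, (#|J| <= s)%N ==> (i \notin J) ==> (subsum A J != psum A i j)]]].

Lemma hit_pointwise i A : 0 \notin G' ->
  (2 * (\sum_(j | j != i) (psum A i j \in G')) <=
   2 * hit i A
   + \sum_(j | j != i) \sum_(j' | (j' != i) && (j != j'))
         ((psum A i j \in G') && (psum A i j' \in G'))
   + 2 * \sum_(j | j != i) \sum_(J : {set 'I_m} | [&& J != set0, (#|J| <= s)%N & i \notin J])
        ((psum A i j \in G') && (subsum A J == psum A i j)))%N.
Proof.
move=> G'0.
(* With [n := #|X|] this is Bonferroni's [n - n (n - 1) / 2 <= 1] when [i] is hit;
   otherwise every [j] in [X] contributes a collision to the last sum. *)
pose X := [set j | (j != i) && (psum A i j \in G')].
have -> : (\sum_(j | j != i) (psum A i j \in G') = #|X|)%N.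
  rewrite -sum1_card big_mkcond [RHS]big_mkcond; apply: eq_bigr => j _.
  by rewrite inE; case: (j != i) => //=; case: (_ \in _).
have -> : (\sum_(j | j != i) \sum_(j' | (j' != i) && (j != j'))
         ((psum A i j \in G') && (psum A i j' \in G')) = #|X| * #|X|.-1)%N.
  rewrite -sum_nat_const big_mkcond [RHS]big_mkcond; apply: eq_bigr => j _.
  rewrite inE; case: (boolP (j != i)) => //= ji.
  case: ifPn => [jG|jG]; last by rewrite big1.
  have jX : j \in X by rewrite inE ji.
  rewrite (cardsD1 j X) jX /= -sum1_card big_mkcond [RHS]big_mkcond; apply: eq_bigr => j' _.
  by rewrite !inE (eq_sym j); case: (j' != i) => //=; case: (j' != j) => //=; case: (_ \in _).
have [h|/existsPn nh] := boolP (hit i A); first by case: #|X| => [|[|x]] /=; nia.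
rewrite muln0 add0n (leq_trans _ (leq_addl _ _)) // leq_mul2l /=.
rewrite -sum1_card big_mkcond [leqRHS]big_mkcond; apply: leq_sum => j _.
rewrite inE; move: (nh j); case: (j != i) => //=.
case: ifPn => //= jG; rewrite negb_forall => /existsP[J].
rewrite !negb_imply => /= /and3P[leJ iJ]; rewrite andbT => eqJ.
have J0 : J != set0.
  by apply: contra G'0 => /eqP J0; move: jG; rewrite -(eqP eqJ) J0 /subsum big_set0.
by rewrite (bigD1 J) /= ?eqJ // J0 leJ.
Qed.

Lemma sum_mem_card (T : finType) (P : pred T) : (\sum_(x : T) P x = #|[set x | P x]|)%N.
Proof. by rewrite -sum1dep_card [RHS]big_mkcond; apply: eq_bigr => x _; case: (P x). Qed.

(** This sums [hit_pointwise] over all inputs: the linear term is bounded below by [card_sum_ge],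
    the pair and collision terms above by the triangular counts. The factor [#|G| ^ 2] clears
    denominators. *)
Lemma card_hit i : (0 < s)%N -> 0 \notin G' ->
  (2 * m.-1 * #|G'| * #|G| * #|G| ^ m <=
   2 * #|[set A : {ffun 'I_m -> G} | hit i A]| * #|G| ^ 2
   + m.-1 * m.-2 * #|G'| ^ 2 * #|G| ^ m
   + 2 * m.-1 * m ^ s * #|G'| * #|G| ^ m)%N.
Proof.
move=> s_gt0 G'0.
have cm : (#|[set j | j != i]| = m.-1)%N.
  by have := cardsC1 i; rewrite card_ord => <-; apply: eq_card => j; rewrite !inE.
have sum1 : (m.-1 * #|G'| * #|G| ^ m <=
   (\sum_(A : {ffun 'I_m -> G}) \sum_(j | j != i) (psum A i j \in G')) * #|G|)%N.
  rewrite exchange_big /= big_distrl /= -cm -sum1dep_card -mulnA big_distrl /=.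
  by apply: leq_sum => j ji; rewrite mul1n sum_mem_card card_sum_ge.
have sum2 : ((\sum_(A : {ffun 'I_m -> G}) \sum_(j | j != i) \sum_(j' | (j' != i) && (j != j'))
         ((psum A i j \in G') && (psum A i j' \in G'))) * #|G| ^ 2 <=
     m.-1 * m.-2 * #|G'| ^ 2 * #|G| ^ m)%N.
  rewrite exchange_big /= big_distrl /= -!mulnA -{1}cm -sum1dep_card big_distrl /=.
  apply: leq_sum => j ji; rewrite mul1n exchange_big /= big_distrl /=.
  have -> : (m.-2 = \sum_(j' | (j' != i) && (j != j')) 1)%N.
    rewrite sum1dep_card -cm (cardsD1 j) inE ji /=.
    by apply: eq_card => j'; rewrite !inE andbC (eq_sym j).
  rewrite big_distrl /=; apply: leq_sum => j' /andP[j'i jj'].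
  by rewrite mul1n sum_mem_card mulnA mulnn; exact: card_two_sums.
have sum3 : ((\sum_(A : {ffun 'I_m -> G}) \sum_(j | j != i)
     \sum_(J : {set 'I_m} | [&& J != set0, (#|J| <= s)%N & i \notin J])
        ((psum A i j \in G') && (subsum A J == psum A i j))) * #|G| ^ 2 <=
     m.-1 * m ^ s * #|G'| * #|G| ^ m)%N.
  rewrite exchange_big /= big_distrl /= -!mulnA -cm -sum1dep_card big_distrl /=.
  apply: leq_sum => j ji; rewrite mul1n exchange_big /= big_distrl /=.
  apply: (@leq_trans (\sum_(J : {set 'I_m} | [&& J != set0, (#|J| <= s)%N & i \notin J])
     (#|G'| * #|G| ^ m))).
    by apply: leq_sum => J /and3P[J0 _ iJ]; rewrite sum_mem_card; exact: card_colliding_sum.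
  rewrite sum_nat_const leq_mul2r; apply/orP; right.
  apply: leq_trans (card_small_subsets s_gt0); apply/subset_leq_card/subsetP => J.
  by rewrite !inE unfold_in => /and3P[-> ->].
have := @leq_sum _ (index_enum _) predT _ _ (fun A _ => hit_pointwise i A G'0).
rewrite /= !big_split /= !big1_eq sum_mem_card.
move: sum1 sum2 sum3; set s1 := (\sum_A _)%N; set s2 := (\sum_A _)%N; set s3 := (\sum_A _)%N.
rewrite -!mulnn; move: #|[set A | _]| => H.
move: (m ^ s)%N m.-1 m.-2 #|G'| #|G| => q m1 m2 g' g.
move: (g ^ m)%N => p h1 h2 h3 h.
have := leq_mul h (leqnn (g * g)); rewrite !mulnDl.
have : (m1 * g' * p * g <= s1 * g * g)%N by rewrite leq_mul2r h1 orbT.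
by move: h2 h3; lia.
Qed.
End Systems.

(** * The encoding argument *)

Section Encoding.
Variables (G : finZmodType) (m s : nat) (G' : {set G}).
Implicit Types (A : {ffun 'I_m -> G}) (i j : 'I_m) (b : G).

(** Put [mu = (m - 1) |G'| / |G|], which is at least [1/4]. In [card_hit] the pairs cost at most
    [mu / 2] and the collisions at most [mu / 4] out of [2 mu], so a hit has probability at least
    [5 mu / 8]. *)
Lemma card_hit_ge i : (0 < s)%N -> 0 \notin G' -> (8 * m ^ s <= #|G|)%N ->
  (2 * m * #|G'| <= #|G|)%N -> (#|G| <= 4 * m.-1 * #|G'|)%N ->
  (#|G| ^ m <= 8 * #|[set A : {ffun 'I_m -> G} | hit s G' i A]|)%N.
Proof.
move=> s_gt0 G'0 le_q le_g' ge_g'; have := card_hit i s_gt0 G'0.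
have g_gt0 : (0 < #|G|)%N by apply/card_gt0P; exists 0.
move: le_q le_g' ge_g' g_gt0; rewrite -!mulnn; move: #|[set A | _]| => H.
have : (m.-2 <= m)%N by lia.
move: (m ^ s)%N m.-1 m.-2 #|G'| #|G| => q m1 m2 g' g.
move: (g ^ m)%N => p m2_le le_q le_g' ge_g' g_gt0 h.
rewrite -(leq_pmul2r g_gt0) -(leq_pmul2r g_gt0).
have e1 : (m1 * m2 * (g' * g') * p * 2 <= m1 * g' * p * g)%N.
  have : (m2 * g' * 2 <= g)%N by nia.
  by move/(leq_mul (leqnn (m1 * g' * p))); lia.
have e2 : (m1 * q * g' * p * 8 <= m1 * g' * p * g)%N.
  by move: le_q => /(leq_mul (leqnn (m1 * g' * p))); lia.
have e3 : (p * g * g <= 4 * (m1 * g' * p * g))%N.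
  by move: ge_g' => /(leq_mul (leqnn (p * g))); lia.
by lia.
Qed.

(** Reverse Markov inequality: the mean number of hit indices is at least [m / 8], and inputs with
    fewer than [m / 16] of them account for at most half of that. *)
Lemma card_many_hits : (0 < m)%N -> (0 < s)%N -> 0 \notin G' -> (8 * m ^ s <= #|G|)%N ->
  (2 * m * #|G'| <= #|G|)%N -> (#|G| <= 4 * m.-1 * #|G'|)%N ->
  (#|G| ^ m <=
   16 * #|[set A : {ffun 'I_m -> G} | m <= 16 * #|[set i : 'I_m | hit s G' i A]|]|)%N.
Proof.
move=> m_gt0 s_gt0 G'0 le_q le_g' ge_g'.
set X := [set A | _].
have le1 : (m * #|G| ^ m <= 8 * \sum_A #|[set i : 'I_m | hit s G' i A]|)%N.
  have -> : (\sum_A #|[set i : 'I_m | hit s G' i A]| =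
      \sum_i #|[set A : {ffun 'I_m -> G} | hit s G' i A]|)%N.
    under eq_bigr do rewrite -sum_mem_card.
    by rewrite exchange_big /=; apply: eq_bigr => i _; rewrite sum_mem_card.
  rewrite -{1}(card_ord m) -sum_nat_const big_distrr /=.
  by apply: leq_sum => i _; exact: card_hit_ge.
have le2 : (16 * \sum_A #|[set i : 'I_m | hit s G' i A]| <= 16 * m * #|X| + m * #|G| ^ m)%N.
  have -> : (#|G| ^ m = #|{: {ffun 'I_m -> G}}|)%N by rewrite card_ffun card_ord.
  rewrite -sum_mem_card !big_distrr /= [(m * #|_|)%N]mulnC -sum_nat_const -big_split /=.
  apply: leq_sum => A _; have := max_card [set i : 'I_m | hit s G' i A].
  by rewrite card_ord; case: (leqP m (16 * _)) => /=; lia.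
rewrite -(leq_pmul2l m_gt0); move: le1 le2; move: #|X| (\sum_A _)%N (#|G| ^ m)%N => x y z.
by lia.
Qed.

(** Once the answers [I] are fixed, a pivot and a query determine the whole equation, so only these
    pairs need to be encoded. *)
Definition equations (I : G -> {set 'I_m}) (t : seq ('I_m * G)) :=
  [seq (p.1, I p.2, p.2) | p <- t].

Definition small_answers (I : G -> {set 'I_m}) : {set 'I_m * G} :=
  [set p | [&& p.2 \in G', p.1 \in I p.2 & (#|I p.2| <= s)%N]].

Lemma card_small_answers I : (#|small_answers I| <= s * #|G'|)%N.
Proof.
rewrite -sum1_card (partition_big (fun p => p.2) (mem G')) /=; last first.
  by move=> p; rewrite inE => /and3P[].
have pair_inj b : injective (fun i : 'I_m => (i, b)) by move=> i j [].
rewrite mulnC -sum_nat_const; apply: leq_sum => b _; rewrite sum1dep_card.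
have [le|lt] := leqP #|I b| s.
  rewrite (leq_trans _ le) // -(card_imset _ (pair_inj b)).
  apply/subset_leq_card/subsetP => -[i b']; rewrite !inE /= => /andP[/and3P[_ iI _] /eqP e].
  by rewrite e in iI *; rewrite imset_f.
rewrite (_ : [set _ | _] = set0) ?cards0 //; apply/setP => -[i b']; rewrite !inE /=.
by apply/negP => /andP[/and3P[_ _ le] /eqP e]; move: le; rewrite e leqNgt lt.
Qed.

Lemma hits_triangular (I : G -> {set 'I_m}) A r : (0 < s)%N ->
  (forall i j, j != i -> psum A i j \in G' ->
     (#|I (psum A i j)| <= s)%N /\ subsum A (I (psum A i j)) = psum A i j) ->
  (r * s <= #|[set i : 'I_m | hit s G' i A]|)%N ->
  exists t : seq ('I_m * G), [/\ size t = r, all (mem (small_answers I)) t,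
    triangular (equations I t) & A \in solutions (equations I t)].
Proof.
move=> s_gt0 I_ok; elim: r => [_|r IH le_r]; first by exists [::]; rewrite inE.
have [|t [size_t t_small t_tri At]] := IH.
  by apply: leq_trans le_r; rewrite leq_mul2r leqnSn orbT.
(* A hit index outside all earlier supports can serve as pivot of a new equation at the front; [C]
   is too small to contain every hit index. *)
pose C := \bigcup_(p <- t) I p.2.
have cardC : (#|C| <= r * s)%N.
  rewrite -size_t /C; elim: (t) t_small => [|p t' IHt] /=; first by rewrite big_nil cards0.
  rewrite inE => /andP[/and3P[_ _ le] /IHt le']; rewrite big_cons mulSn.
  by rewrite (leq_trans (leq_card_setU _ _)) // leq_add.
have [i] : exists i, i \in [set i : 'I_m | hit s G' i A] :\: C.
  apply/set0Pn; rewrite -card_gt0; move: (cardsD [set i : 'I_m | hit s G' i A] C).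
  have := subset_leq_card (subsetIr [set i : 'I_m | hit s G' i A] C).
  move=> le_C ->; rewrite subn_gt0 (leq_ltn_trans le_C) // (leq_ltn_trans cardC) //.
  by rewrite (leq_trans _ le_r) // mulSn -[X in (X < _)%N]add0n ltn_add2r.
rewrite !inE => /andP[iC /existsP[j /and3P[ji bG' /forallP no_other]]].
have [le_s eq_b] := I_ok _ _ ji bG'.
set b := psum A i j in bG' no_other le_s eq_b.
(* Otherwise the answer itself would be a small set avoiding [i] with sum [b], against the
   definition of [hit]. *)
have iI : i \in I b.
  have := no_other (I b); rewrite le_s /= eq_b eqxx /= implybF negbK //.
exists ((i, b) :: t); split => /=.
- by rewrite size_t.
- by rewrite t_small inE /= bG' iI le_s.
- rewrite iI t_tri andbT /=; apply/allP => _ /mapP[p pt ->] /=.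
  by apply: contra iC => iIp; rewrite /C (big_rem p pt) /= inE iIp.
- by move: At; rewrite !inE /= eq_b eqxx.
Qed.

(** Union bound over the at most [(s * #|G'|) ^ r] encoded systems, each solved by at most a
    fraction [#|G| ^- r] of all inputs. *)
Lemma card_triangular (I : G -> {set 'I_m}) (X : {set {ffun 'I_m -> G}}) r :
  (forall A, A \in X -> exists t : seq ('I_m * G),
    [/\ size t = r, all (mem (small_answers I)) t,
    triangular (equations I t) & A \in solutions (equations I t)]) ->
  (#|X| * #|G| ^ r <= (s * #|G'|) ^ r * #|G| ^ m)%N.
Proof.
move=> X_ok; pose P := {p | p \in small_answers I}.
pose eqs (t : r.-tuple P) := equations I (map val t).
pose Q := [set t : r.-tuple P | triangular (eqs t)].
have le_Q : (#|Q| <= (s * #|G'|) ^ r)%N.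
  rewrite (leq_trans (max_card _)) // card_tuple card_sig.
  by case: r {eqs Q X_ok} => // r; rewrite leq_exp2r // card_small_answers.
apply: leq_trans (_ : #|Q| * #|G| ^ m <= _)%N; last by rewrite leq_mul2r le_Q orbT.
apply: (@card_union_bound _ _ Q (fun t => solutions (eqs t))).
  apply/subsetP => A /X_ok[t [size_t /allP t_small t_tri At]]; apply/bigcupP.
  have /eqP size_t' : size (pmap insub t : seq P) = r.
    rewrite size_pmap_sub -size_t; apply/eqP; rewrite -all_count; exact/allP.
  have eq_t : map val (Tuple size_t') = t.
    rewrite /= (pmap_filter (insubK _)).
    by apply/all_filterP/allP => p /t_small; rewrite /= isSome_insub.
  by exists (Tuple size_t'); [rewrite inE /eqs eq_t | rewrite /eqs eq_t].
by move=> t; rewrite inE => /card_solutions; rewrite /eqs /equations !size_map size_tuple.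
Qed.

Lemma encoding_bound (F : finType) (st : {ffun 'I_m -> G} -> F)
    (ans : F -> G -> {set 'I_m}) r :
  (0 < m)%N -> (0 < s)%N -> 0 \notin G' -> (8 * m ^ s <= #|G|)%N ->
  (2 * m * #|G'| <= #|G|)%N -> (#|G| <= 4 * m.-1 * #|G'|)%N ->
  (forall A i j, j != i -> psum A i j \in G' ->
     (#|ans (st A) (psum A i j)| <= s)%N /\
     subsum A (ans (st A) (psum A i j)) = psum A i j) ->
  (16 * (r * s) <= m)%N ->
  (#|G| ^ r <= 16 * #|F| * (s * #|G'|) ^ r)%N.
Proof.
move=> m_gt0 s_gt0 G'0 le_q le_g' ge_g' ans_ok le_r.
have := card_many_hits m_gt0 s_gt0 G'0 le_q le_g' ge_g'.
set X := [set A | _] => le_X.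
have g_gt0 : (0 < #|G| ^ m)%N by rewrite expn_gt0; apply/orP; left; apply/card_gt0P; exists 0.
have le2 : (#|X| * #|G| ^ r <= #|F| * ((s * #|G'|) ^ r * #|G| ^ m))%N.
  rewrite -[#|F|]cardsT.
  (* [X] is split by state, since a fixed state fixes the answer function and [card_triangular] then
     applies. *)
  apply: (@card_union_bound _ _ setT (fun f => [set A in X | st A == f])).
    by apply/subsetP => A AX; apply/bigcupP; exists (st A); rewrite // inE AX eqxx.
  move=> f _; apply: (@card_triangular (ans f)) => A; rewrite !inE => /andP[hA /eqP eA].
  apply: hits_triangular => // [i j|]; first by rewrite -eA; exact: ans_ok.
  by lia.
rewrite -(leq_pmul2r g_gt0); move: le2 le_X; move: #|X| (#|G| ^ m)%N => x y le2 le_X.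
have := leq_mul le_X (leqnn (#|G| ^ r)); move: le2.
by move: (#|G| ^ r)%N ((s * #|G'|) ^ r)%N => a b; lia.
Qed.
End Encoding.

(** * Cell sampling and non-adaptive algorithms *)

(** Running against an oracle for cell contents lets answers be computed from the sampled cells
    alone. *)
Fixpoint run_fun w Out (p : cell_probe w Out) (f : nat -> option (word w)) : Out :=
  match p with
  | Output o => o
  | Probe i next => run_fun (next (f i)) f
  end.

Lemma run_run_fun w Out (p : cell_probe w Out) (D : seq (word w)) f :
  {in probes p D, onth D =1 f} -> run p D = run_fun p f.
Proof.
elim: p => [o|i next IH] //= eq_f; rewrite -(eq_f i) ?inE ?eqxx //.
by apply: IH => a a_in; apply: eq_f; rewrite inE a_in orbT.
Qed.

(** Addresses from [S] on read [None] in every data structure of at most [S] cells, hence carry no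
    information. *)
Definition probes_within (S : nat) (P L : seq nat) := all (fun a => (a < S)%N ==> (a \in L)) P.

(* Cut the [S] cells into [K] blocks and sort the queries by the tuple of blocks
   that they probe: the most frequent tuple serves a fraction [K ^- T] of them. *)
Lemma cell_sampling (X : finType) (P : X -> seq nat) (S T K : nat) :
  (0 < K)%N -> (forall x, size (P x) <= T)%N ->
  exists L : seq nat, size L = (T * (S %/ K).+1)%N /\
    (#|X| <= K ^ T * #|[set x | probes_within S (P x) L]|)%N.
Proof.
case: K => // K _ size_P; set B := (S %/ K.+1).+1.
(* The block length [B] is rounded up so that the blocks cover all [S] cells. Short probe lists are
   padded with address [0]; only addresses from [S] on can overflow in [inord], and [probes_within]
   ignores them. *)
pose blk x : T.-tuple 'I_K.+1 := [tuple inord (nth 0%N (P x) j %/ B) | j < T].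
pose L (t : T.-tuple 'I_K.+1) := flatten [seq iota (j * B) B | j : 'I_K.+1 <- t].
have size_L t : size (L t) = (T * B)%N.
  rewrite /L size_flatten /shape -map_comp -[in RHS](size_tuple t).
  elim: (tval t) => //= j t' ->; rewrite size_iota mulSn //.
have L_ok x : probes_within S (P x) (L (blk x)).
  apply/allP => a aP; apply/implyP => aS; apply/flattenP.
  have lt_j : (index a (P x) < T)%N by rewrite (leq_trans _ (size_P x)) // index_mem.
  pose j := Ordinal lt_j.
  have eq_j : nth 0%N (P x) j = a by rewrite nth_index.
  have lt_aB : (a %/ B < K.+1)%N.
    rewrite ltn_divLR // (leq_trans aS) // /B mulnC mulSn.
    by rewrite {1}(divn_eq S K.+1) addnC leq_add2r ltnW // ltn_mod.
  exists (iota ((a %/ B) * B) B); last first.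
    by rewrite mem_iota leq_trunc_div /= -{1}mulSnr -ltn_divLR.
  apply/mapP; exists (tnth (blk x) j); first exact: mem_tnth.
  by rewrite tnth_mktuple eq_j inordK.
suff [t le_t] : exists t, (#|X| <= K.+1 ^ T * #|[set x | blk x == t]|)%N.
  exists (L t); split => //; apply: (leq_trans le_t); rewrite leq_mul2l; apply/orP; right.
  by apply/subset_leq_card/subsetP => x; rewrite !inE => /eqP <-.
have [//|X_gt0] := posnP #|X|.
  by move=> X0; exists [tuple ord0 | _ < T]; rewrite X0.
(* If every tuple served too few queries, summing over all tuples would count fewer than [#|X|]
   queries. *)
apply/existsP; apply: contraT => /existsPn lt_t.
have : (\sum_(t : T.-tuple 'I_K.+1) K.+1 ^ T * #|[set x | blk x == t]|
    < \sum_(t : T.-tuple 'I_K.+1) #|X|)%N.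
  rewrite (bigD1 [tuple ord0 | _ < T]) //= [ltnRHS](bigD1 [tuple ord0 | _ < T]) //=.
  rewrite -addSn leq_add //; first by rewrite ltnNge lt_t.
  by apply: leq_sum => t _; rewrite ltnW // ltnNge lt_t.
rewrite sum_nat_const card_tuple card_ord -big_distrr /= ltn_mul2l => /andP[_].
rewrite -[#|X|]sum1_card (partition_big blk xpredT) //= ltnNge.
by move/negP; case; apply: leq_sum => t _; rewrite sum1dep_card.
Qed.

Lemma subset_of_card (T : finType) (X : {set T}) n : (n <= #|X|)%N ->
  exists2 Y : {set T}, Y \subset X & #|Y| = n.
Proof.
move=> le_n; exists [set x in take n (enum X)].
  by apply/subsetP => x; rewrite inE => /mem_take; rewrite mem_enum.
rewrite cardsE (card_uniqP _) ?take_uniq ?enum_uniq //.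
by rewrite size_takel // -cardE.
Qed.

(** * Zero-padded inputs and the content of the sampled cells *)

Section Reduction.
Variables (G : finZmodType) (N k w S T : nat) (alg : indexing_alg G N w).
Hypotheses (alg_ok : solves_ksum_indexing k S T alg) (alg_na : non_adaptive k alg).

(** By non-adaptivity the picked input matters only for order and repetitions. A [b] that is a query
    of no input gets the empty list. *)
Definition probe_set (b : G) : seq nat :=
  if [pick A : N.-tuple G | b \in ksum_queries k A] is Some A
  then probes (answer alg b) (preprocess alg A) else [::].

Lemma probe_setP A b : b \in ksum_queries k A ->
  probes (answer alg b) (preprocess alg A) =i probe_set b.
Proof.
move=> bA; rewrite /probe_set; case: pickP => [A' bA'|/(_ A)]; last by rewrite bA.
exact: alg_na.
Qed.

Lemma size_probe_set b : (size (probe_set b) <= T)%N.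
Proof.
rewrite /probe_set; case: pickP => // A bA; by have [_ /(_ b bA)[]] := alg_ok A.
Qed.

Variable m : nat.
Hypotheses (m_le : (m + k.-1 <= N)%N) (k_ge3 : (3 <= k)%N).

Definition pad (A : {ffun 'I_m -> G}) : N.-tuple G :=
  [tuple oapp A 0 (insub (val i)) | i < N].

Definition restr (I : {set 'I_N}) : {set 'I_m} :=
  [set j : 'I_m | [exists i in I, val i == val j]].

Lemma m_leN : (m <= N)%N.
Proof. exact: leq_trans (leq_addr _ _) m_le. Qed.

Lemma mem_restr I j : (j \in restr I) = (widen_ord m_leN j \in I).
Proof.
rewrite inE; apply/existsP/idP => [[i /andP[iI /eqP e]]|jI].
  by rewrite (_ : widen_ord _ _ = i) //; apply/val_inj.
by exists (widen_ord m_leN j); rewrite jI /=.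
Qed.

Lemma card_restr I : (#|restr I| <= #|I|)%N.
Proof.
have inj : injective (widen_ord m_leN) by move=> i j /(congr1 val) /= /val_inj.
rewrite -(card_imset _ inj); apply/subset_leq_card/subsetP => i /imsetP[j].
by rewrite mem_restr => h ->.
Qed.

Lemma sum_pad A (I : {set 'I_N}) : \sum_(i in I) tnth (pad A) i = subsum A (restr I).
Proof.
have inj : injective (widen_ord m_leN) by move=> i j /(congr1 val) /= /val_inj.
rewrite /subsum (bigID (fun i : 'I_N => (i < m)%N)) /= addrC big1 ?add0r; last first.
  by move=> i /andP[_ /negbTE i_ge]; rewrite tnth_mktuple insubN //= i_ge.
rewrite (eq_bigl (mem (widen_ord m_leN @: restr I))); last first.
  move=> i; apply/andP/imsetP => [[iI lt_i]|[j]].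
    by exists (Ordinal lt_i); [rewrite mem_restr (_ : widen_ord _ _ = i) //|]; apply/val_inj.
  by rewrite mem_restr => jI ->; rewrite jI /=.
rewrite big_imset /=; last by move=> ? ? _ _ /inj.
apply: eq_bigr => j _; rewrite tnth_mktuple /= insubT //= => h; congr (A _); exact/val_inj.
Qed.

(** The pair of indices is completed to [k - 1] indices by [k - 3] padding positions, whose entries
    are zero. *)
Lemma pair_query (A : {ffun 'I_m -> G}) i j : j != i -> A i + A j \in ksum_queries k (pad A).
Proof.
move=> ji.
have [Z Z_sub cardZ] : exists2 Z : {set 'I_N},
    Z \subset [set x : 'I_N | (m <= x)%N] &
    #|Z| = k.-1.-2.
  apply: subset_of_card.
  have -> : [set x : 'I_N | (m <= x)%N] = ~: [set widen_ord m_leN x | x : 'I_m].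
    apply/setP => x; rewrite !inE leqNgt; congr (~~ _).
    apply/idP/imsetP => [lt|[y _ ->]] //=; by exists (Ordinal lt) => //; exact/val_inj.
  have inj : injective (widen_ord m_leN) by move=> x y /(congr1 val) /= /val_inj.
  have := cardsC [set widen_ord m_leN x | x : 'I_m]; rewrite card_imset // !card_ord.
  by move: #|~: _| => n; have := m_le; lia.
pose W := [set widen_ord m_leN i; widen_ord m_leN j].
have WZ : [disjoint W & Z].
  rewrite disjoint_subset; apply/subsetP => x xW; rewrite inE; apply/negP => /(subsetP Z_sub).
  rewrite inE leqNgt => /negP; apply; move: xW; rewrite !inE.
  by move=> /orP[] /eqP -> /=; exact: ltn_ord.
have cW : #|W| = 2 by rewrite cards2 -val_eqE /= val_eqE eq_sym ji.
apply/imsetP; exists (W :|: Z).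
  by rewrite inE cardsU (disjoint_setI0 WZ) cards0 cW cardZ; move: k_ge3; lia.
rewrite sum_pad -subsum2 1?eq_sym //; congr subsum; apply/setP => x; rewrite mem_restr !inE.
rewrite -!val_eqE /= !val_eqE; case: (boolP (widen_ord _ _ \in Z));
  rewrite ?orbF // => /(subsetP Z_sub).
by rewrite inE /= leqNgt ltn_ord.
Qed.

(** This is [encoding_bound] with the content of [L] as state. A cell may be absent, which gives
    [2 ^ w + 1] possible contents per address. *)
Lemma state_bound (L : seq nat) (G' : {set G}) r :
  {in G', forall b, probes_within S (probe_set b) L} ->
  (0 < m)%N -> 0 \notin G' -> (8 * m ^ k.-1 <= #|G|)%N ->
  (2 * m * #|G'| <= #|G|)%N -> (#|G| <= 4 * m.-1 * #|G'|)%N ->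
  (16 * (r * k.-1) <= m)%N ->
  (#|G| ^ r <= 16 * (2 ^ w).+1 ^ size L * (k.-1 * #|G'|) ^ r)%N.
Proof.
move=> L_ok m_gt0 G'0 le_q le_g' ge_g' le_r.
pose F := {ffun 'I_(size L) -> option (w.-tuple bool)}.
have cardF : #|{: F}| = ((2 ^ w).+1 ^ size L)%N.
  by rewrite card_ffun card_option card_tuple card_bool card_ord.
pose st (A : {ffun 'I_m -> G}) : F :=
  [ffun x : 'I_(size L) => onth (preprocess alg (pad A)) (nth 0%N L x)].
pose f (sg : F) (a : nat) : option (word w) := obind sg (insub (index a L)).
pose ans (sg : F) (b : G) := restr (run_fun (answer alg b) (f sg)).
rewrite -cardF; apply: (@encoding_bound G m k.-1 G' F st ans) => //.
  by move: k_ge3; lia.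
move=> A i j ji bG'; have bQ := pair_query A ji.
set b := A i + A j in bG' bQ *.
have [size_D /(_ b bQ)[_ card_I sum_I]] := alg_ok (pad A).
suff eq_run : run (answer alg b) (preprocess alg (pad A)) = run_fun (answer alg b) (f (st A)).
  by rewrite /ans -eq_run -sum_pad sum_I; split => //; rewrite -card_I card_restr.
apply: run_run_fun => a; rewrite (probe_setP bQ) => aP.
have /allP/(_ a aP)/implyP aL := L_ok b bG'.
rewrite /f; case: insubP => [x|] /=.
  by rewrite index_mem => aL' e; rewrite ffunE e nth_index.
(* A probed address outside [L] is at least [S], so the data structure reads [None] there, as [f]
   does. *)
rewrite index_mem => aL'; apply: onth_default.
by rewrite leqNgt; apply: contra aL' => lt; apply: aL; apply: leq_trans lt size_D.
Qed.
End Reduction.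

(** * Numerical consequences *)

(** The two roundings lose at most [128 * s], which is at most half of [N]. *)
Lemma le_mul_divn_divn (N s : nat) : (0 < s)%N -> (272 * s <= N)%N ->
  (N <= 256 * (s * (N %/ 8 %/ (16 * s))))%N.
Proof.
move=> s_gt0 s_le; set m := (N %/ 8)%N; set r := (m %/ _)%N.
have h1 : (m < (16 * s) * r.+1)%N by rewrite mulnC ltn_ceil // muln_gt0.
have h2 : (N < 8 * m.+1)%N by rewrite mulnC ltn_ceil.
by move: h1; rewrite mulnS -mulnA; lia.
Qed.

Section CountBound.
Variables (G : finZmodType) (N k w S T : nat) (alg : indexing_alg G N w).
Hypotheses (alg_ok : solves_ksum_indexing k S T alg) (alg_na : non_adaptive k alg).
Hypotheses (k_ge3 : (3 <= k)%N) (N_ge : (272 * k.-1 <= N)%N).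
Hypotheses (N_ge2 : (64 * k.-1 ^ 2 <= N)%N) (G_ge : (N ^ k.-1 <= #|G|)%N).

Let m := (N %/ 8)%N.
Let s := k.-1.
Let r := (m %/ (16 * s))%N.

(** For [G'] of size about [|G| / 2m], an equation is encoded by one of [s |G'|] pairs and replaces
    one of [|G|] values, a saving of at least [2m / s]. *)
Lemma count_bound (L : seq nat) :
  (#|G| <= m * #|[set b | probes_within S (probe_set k alg b) L]|)%N ->
  ((2 * m) ^ r <= 16 * (2 ^ w).+1 ^ size L * s ^ r)%N.
Proof.
move=> G_le; set Q := [set b | _] in G_le.
have s_ge2 : (2 <= s)%N by rewrite /s; lia.
have le_m : (8 * m <= N)%N by rewrite /m; lia.
have m_ge : (60 <= m)%N by move: N_ge s_ge2; rewrite /m -/s; lia.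
have s_le : (272 * s <= N)%N := N_ge.
have le_q : (8 * m ^ s <= #|G|)%N.
  apply: leq_trans G_ge; rewrite -/s.
  apply: (@leq_trans ((8 * m) ^ s)); last by rewrite leq_exp2r //; lia.
  by rewrite expnMn leq_mul2r -{1}(expn1 8) leq_exp2l ?orbT //; lia.
have g_ge : (4 * m <= #|G|)%N.
  apply: leq_trans le_q; apply: (@leq_trans (8 * m ^ 1)); first by rewrite expn1; lia.
  by rewrite leq_mul2l /= leq_exp2l; lia.
(* This is the largest size of [G'] with [2 * m * #|G'| <= #|G|]. Since [#|Q|] is at least [2 * n],
   enough queries remain after removing [0]. *)
pose n := (#|G| %/ (2 * m))%N.
have n_le : (2 * m * n <= #|G|)%N by rewrite mulnC leq_trunc_div.
have n_gt : (#|G| < 2 * m * n.+1)%N by rewrite mulnC ltn_ceil //; lia.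
have n_ge2 : (2 <= n)%N by rewrite leq_divRL; lia.
have [G' G'_sub cardG'] : exists2 G' : {set G}, G' \subset Q :\ 0 & #|G'| = n.
  apply: subset_of_card; have := cardsD1 0 Q.
  have : (2 * n <= #|Q|)%N.
    have : (m * (2 * n) <= m * #|Q|)%N by apply: leq_trans G_le; lia.
    by rewrite leq_mul2l => /orP[/eqP|//]; lia.
  by move: #|Q| #|Q :\ 0| => a b; case: (0 \in Q) => /=; lia.
have m_pos : (0 < m)%N by lia.
have mN : (m + s <= N)%N by lia.
have G'0 : 0 \notin G' by apply/negP => /(subsetP G'_sub); rewrite !inE eqxx.
have G'_ok : {in G', forall b, probes_within S (probe_set k alg b) L}.
  by move=> b /(subsetP G'_sub); rewrite !inE => /andP[].
have le_r : (16 * (r * s) <= m)%N by rewrite mulnCA mulnC [(_ * r)%N]mulnC leq_trunc_div.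
have le2 : (2 * m * #|G'| <= #|G|)%N by rewrite cardG'.
have le3 : (#|G| <= 4 * m.-1 * #|G'|)%N.
  rewrite cardG'; apply: (leq_trans (ltnW n_gt)).
  have -> : (4 * m.-1 * n = 4 * m * n - 4 * n)%N.
    by rewrite -{2}(prednK m_pos) mulnS mulnDl addnC addnK.
  rewrite leq_subRL; first by nia.
  by rewrite -mulnA leq_mul2l leq_pmull.
have := state_bound alg_ok alg_na mN k_ge3 G'_ok m_pos G'0 le_q le2 le3 le_r.
rewrite cardG' -/s => main.
have g_gt0 : (0 < #|G| ^ r)%N by rewrite expn_gt0 (leq_trans _ g_ge) // muln_gt0.
rewrite -(leq_pmul2r g_gt0).
apply: (@leq_trans ((2 * m) ^ r * (16 * (2 ^ w).+1 ^ size L * (s * n) ^ r))).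
  by rewrite leq_mul2l main orbT.
have -> : ((2 * m) ^ r * (16 * (2 ^ w).+1 ^ size L * (s * n) ^ r) =
    16 * (2 ^ w).+1 ^ size L * s ^ r * (2 * m * n) ^ r)%N by rewrite !expnMn; ring.
rewrite leq_mul2l; apply/orP; right; case: (r) => // r'; by rewrite leq_exp2r.
Qed.

(** From [N >= 64 s^2] the saving [2m / s] is at least the square root of [N]; squaring
    [count_bound] removes this root and turns [16] into [2 ^ 8]. *)
Lemma count_bound_pow2 (L : seq nat) :
  (#|G| <= m * #|[set b | probes_within S (probe_set k alg b) L]|)%N ->
  (N ^ r <= 2 ^ (8 + 2 * (w.+1 * size L)))%N.
Proof.
move=> /count_bound le.
have s_ge2 : (2 <= s)%N by rewrite /s; lia.
have m_ge : (60 <= m)%N by move: N_ge s_ge2; rewrite /m -/s; lia.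
have le_m : (N <= 16 * m)%N by rewrite /m in m_ge *; lia.
have sq : (s ^ 2 * N <= (2 * m) ^ 2)%N.
  have : (64 * s ^ 2 <= N)%N := N_ge2.
  by rewrite -!mulnn; move: (s * s)%N => s2; nia.
have le2 : ((s ^ 2 * N) ^ r <= (16 * (2 ^ w).+1 ^ size L * s ^ r) ^ 2)%N.
  apply: (@leq_trans (((2 * m) ^ r) ^ 2)); last by rewrite leq_exp2r.
  rewrite -expnM [(r * 2)%N]mulnC expnM; case: (r) => // r'; by rewrite leq_exp2r.
have s_gt0 : (0 < (s ^ r) ^ 2)%N by rewrite !expn_gt0; lia.
rewrite -(leq_pmul2l s_gt0).
have -> : ((s ^ r) ^ 2 * N ^ r = (s ^ 2 * N) ^ r)%N.
  by rewrite expnMn -!expnM [(r * 2)%N]mulnC.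
apply: (leq_trans le2); rewrite expnMn mulnC leq_mul2l; apply/orP; right.
have -> : (2 ^ (8 + 2 * (w.+1 * size L)) = 16 ^ 2 * ((2 ^ w.+1) ^ size L) ^ 2)%N.
  by rewrite expnD [(2 * _)%N]mulnC !expnM.
rewrite expnMn leq_mul2l leq_exp2r //; apply/orP; right.
case: (size L) => // l; rewrite leq_exp2r //.
by rewrite expnS mul2n -addnn -addn1 leq_add2l expn_gt0.
Qed.
End CountBound.

(** * Logarithms and real powers *)

Section RealBounds.
Variable R : realType.
Implicit Types x y : R.

Lemma ln2_ge : 2^-1 <= ln (2 : R).
Proof.
have : ln (1 + - (2^-1 : R)) <= - 2^-1 by apply: le_ln1Dx; lra.
have -> : 1 + - (2^-1 : R) = 2^-1 by lra.
by rewrite lnV ?posrE //; lra.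
Qed.

Lemma ln2_le : ln (2 : R) <= 1.
Proof. by have := @le_ln1Dx R 1; rewrite (_ : 1 + 1 = 2 :> R); [apply; lra | lra]. Qed.

Lemma ln4_ge : 1 <= ln (4 : R).
Proof.
have -> : (4 : R) = 2 * 2 by lra.
by rewrite lnM ?posrE //; have := ln2_ge; lra.
Qed.

(** With [q] the square root of [x], [ln x = 2 ln q < 2 q], and the hypothesis says [4 <= y * q]. *)
Lemma ln_le_linear x y : 0 < y -> 16 / y ^+ 2 <= x -> ln x <= y * x / 2.
Proof.
move=> y_gt0 le_x; have y2 : 0 < y ^+ 2 by rewrite exprn_gt0.
have x_gt0 : 0 < x by apply: lt_le_trans le_x; rewrite divr_gt0.
have q_gt0 : 0 < Num.sqrt x by rewrite sqrtr_gt0.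
have eq_x : x = Num.sqrt x ^+ 2 by rewrite sqr_sqrtr // ltW.
have : 4 / y <= Num.sqrt x.
  rewrite -(ler_pXn2r (n := 2)) ?nnegrE ?divr_ge0 ?(ltW q_gt0) ?(ltW y_gt0) // -eq_x expr_div_n.
  by rewrite (_ : 4 ^+ 2 = 16 :> R) //; ring.
rewrite ler_pdivrMr // => le_q.
have -> : ln x = ln (Num.sqrt x) *+ 2 by rewrite -lnXn // -eq_x.
have -> : y * x / 2 = y * Num.sqrt x ^+ 2 / 2 by rewrite -eq_x.
have := ln_sublinear q_gt0; move: (Num.sqrt x) (ln _) q_gt0 le_q => q l q_gt0 le_q lt_l.
have : 0 <= q * (q * y - 4) by rewrite mulr_ge0; lra.
by rewrite mulr2n; nra.
Qed.

Lemma root_le (N T : nat) (C : R) : (0 < T)%N -> 0 <= C ->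
  N%:R <= C ^+ T -> N%:R `^ T%:R^-1 <= C.
Proof.
move=> T_gt0 C_ge0 le_N.
have -> : C = (C ^+ T) `^ T%:R^-1.
  by rewrite -powR_mulrn // -powRrM divff ?powRr1 // pnatr_eq0 -lt0n.
by apply: ge0_ler_powR => //; rewrite ?nnegrE ?exprn_ge0 // invr_ge0.
Qed.

Lemma root_le4 (N T : nat) : (0 < N)%N -> (0 < T)%N ->
  ln (N%:R : R) <= T%:R -> (N%:R : R) `^ T%:R^-1 <= 4.
Proof.
move=> N_gt0 T_gt0 le_T.
rewrite -ler_ln ?posrE ?powR_gt0 ?ltr0n // ln_powR; apply: le_trans ln4_ge.
by rewrite mulrC ler_pdivrMr ?ltr0n // mul1r.
Qed.

(** Taking logarithms gives [r ln N <= 8 + 2 (w + 1) l]; as [r] has order [N] and [w] has order at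
    most [ln N], the logarithms cancel. *)
Lemma sample_size_gt (N r s w l : nat) (c v : R) : 0 < c -> 0 < v ->
  (N <= 256 * (s * r))%N -> (N ^ r <= 2 ^ (8 + 2 * (w.+1 * l)))%N ->
  s%:R <= c -> w%:R <= v * ln (N%:R : R) -> (4 <= N)%N -> 64 * 128 * c <= N%:R ->
  N%:R / (32 * 64 * c * (v + 1)) < l%:R.
Proof.
move=> c_gt0 v_gt0 le_N le_pow le_s le_w N_ge4 le_c.
have N_gt0 : 0 < N%:R :> R by rewrite ltr0n (leq_trans _ N_ge4).
have ln_ge1 : 1 <= ln (N%:R : R).
  by apply: le_trans ln4_ge _; rewrite ler_ln ?posrE // ler_nat.
have h1 : (r%:R : R) * ln N%:R <= 8 + 2 * ((w%:R + 1) * l%:R).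
  have le_powR : (N%:R : R) ^+ r <= 2%:R ^+ (8 + 2 * (w.+1 * l)) by rewrite -!natrX ler_nat.
  have : ln ((N%:R : R) ^+ r) <= ln (2%:R ^+ (8 + 2 * (w.+1 * l)) : R).
    by rewrite ler_ln // posrE exprn_gt0.
  rewrite !lnXn // -[ln N%:R *+ _]mulr_natl -[ln 2%:R *+ _]mulr_natl.
  have -> : (8 + 2 * (w.+1 * l))%:R = 8 + 2 * ((w%:R + 1) * l%:R) :> R.
    by rewrite natrD !natrM -[w.+1]addn1 natrD.
  move=> h; apply: (le_trans h); rewrite ler_piMr ?ln2_le // addr_ge0 // mulr_ge0 // mulr_ge0 //.
  by rewrite addr_ge0.
have h2 : (N%:R : R) <= 256 * (c * r%:R).
  move: le_N; rewrite -(ler_nat R) !natrM => h; apply: (le_trans h).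
  by rewrite ler_pM2l // ler_wpM2r.
rewrite ltNge; apply/negP; rewrite ler_pdivlMr; last by rewrite !mulr_gt0 // addr_gt0.
move: le_w ln_ge1 h1 N_gt0 le_c h2; move: (N%:R : R) (r%:R : R) (ln _) => n q L.
move=> {le_N le_pow N_ge4} le_w L_ge1 h1 n_gt0 le_c h2 le_l.
have l_ge0 : 0 <= l%:R :> R by [].
have h3 : (w%:R + 1) * l%:R <= (v + 1) * L * l%:R.
  by rewrite ler_wpM2r //; nra.
have h4 : n * L <= 256 * c * (q * L).
  have -> : 256 * c * (q * L) = 256 * (c * q) * L by ring.
  by rewrite ler_wpM2r //; lra.
have h5 : 256 * c * (q * L) <= 256 * c * (8 + 2 * ((v + 1) * L * l%:R)).
  by rewrite ler_wpM2l //; lra.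
have h6 : 32 * 64 * c * (v + 1) * l%:R * L <= n * L.
  by rewrite ler_wpM2r //; lra.
have h7 : n <= n * L by rewrite ler_peMr //; lra.
(* Each of the two terms is at most a quarter of [n * L], the first by [64 * 128 * c <= n], so
   together they cannot reach [n * L]. *)
have h8 : 256 * c * (8 + 2 * ((v + 1) * L * l%:R)) =
    32 * 64 * c + (32 * 64 * c * (v + 1) * l%:R * L) / 4.
  by field.
by lra.
Qed.
End RealBounds.

(** * The number of blocks and the bound on [S] *)

Lemma index_card_le (R : realType) (c : R) (N : nat) (G : finZmodType) (index : G -> nat) :
  index_encoding c N index -> #|G|%:R <= N%:R `^ c.
Proof.
move=> [inj le_index]; apply: (@le_trans _ _ (Num.truncn (N%:R `^ c))%:R); last first.
  by rewrite truncn_le powR_ge0.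
rewrite ler_nat cardE -(size_map index) -(size_iota 1 (Num.truncn _)).
apply: uniq_leq_size; first by rewrite map_inj_uniq ?enum_uniq.
move=> _ /mapP[g _ ->]; have [gt0 le] := le_index g.
by rewrite mem_iota gt0 add1n ltnS truncn_ge_nat ?powR_ge0.
Qed.

(** The factor [8] moves inside the power because [T] is positive, and [K.+1 <= 2 * K]. *)
Lemma leq_exp_of_divn_lt (N K T : nat) : (0 < K)%N -> (0 < T)%N ->
  (N %/ 8 < K.+1 ^ T)%N -> (N <= (16 * K) ^ T)%N.
Proof.
move=> K_gt0 T_gt0; rewrite ltn_divLR // => /ltnW lt_N.
have -> : (16 * K = 2 * K * 8)%N by lia.
rewrite expnMn; apply: (leq_trans lt_N); apply: leq_mul.
  by rewrite leq_exp2r // mul2n -addnn -addn1 leq_add2l.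
by rewrite -{1}(expn1 8) leq_pexp2l.
Qed.

Theorem theorem4p1 (R : realType) (c u v : R)
    (c_gt0 : 0 < c) (u_gt0 : 0 < u) (v_gt0 : 0 < v) :
  exists (delta : R) (e N0 : nat), 0 < delta /\
    forall (k N w S T : nat) (G : finZmodType) (index : G -> nat)
           (alg : indexing_alg G N w),
      (3 <= k)%N -> (N0 <= N)%N -> (0 < T)%N ->
      index_encoding c N index ->
      word_length u v N w ->
      (N ^ (k - 1) <= #|G|)%N ->
      solves_ksum_indexing k S T alg ->
      non_adaptive k alg ->
      delta * N%:R `^ (1 + T%:R^-1) / (ln N%:R) ^+ e <= S%:R.
Proof.
set eta := (32 * 64 * c * (v + 1))^-1.
have eta_gt0 : 0 < eta by rewrite invr_gt0 !mulr_gt0 // addr_gt0.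
have big_ge0 : 0 <= 16 / eta ^+ 2 by rewrite divr_ge0 // exprn_ge0 // ltW.
(* The summands of the threshold serve, in order, [ln N >= 1], the bounds of [N] linear in [c], the
   bound [64 s^2 <= N], and [ln N <= eta N / 2]. *)
exists (eta / 64), 1%N, (Num.truncn (16 + 64 * 128 * c + 64 * c ^+ 2 + 16 / eta ^+ 2)).+1.
split; first by rewrite divr_gt0.
move=> k N w S T G index alg k_ge3 N_ge T_gt0 enc /andP[_ le_w].
rewrite subn1 => G_ge alg_ok alg_na.
have c2_ge0 : 0 <= c ^+ 2 by rewrite exprn_ge0 // ltW.
have {}N_ge : 16 + 64 * 128 * c + 64 * c ^+ 2 + 16 / eta ^+ 2 < (N%:R : R).
  by apply: lt_le_trans (truncnS_gt _) _; rewrite ler_nat.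
have N_ge16 : (16 <= N)%N by rewrite -(ler_nat R); lra.
have N_gt0 : 0 < N%:R :> R by lra.
have ln_ge1 : 1 <= ln (N%:R : R).
  by apply: le_trans (ln4_ge R) _; rewrite ler_ln ?posrE //; lra.
(* Comparing [N ^ (k - 1) <= |G|] with [|G| <= N ^ c] bounds [k] by a constant. *)
have s_le : (k.-1)%:R <= c.
  have le : (N%:R : R) ^+ k.-1 <= N%:R `^ c.
    by apply: le_trans (index_card_le enc); rewrite -natrX ler_nat.
  have : ln ((N%:R : R) ^+ k.-1) <= ln (N%:R `^ c).
    by rewrite ler_ln ?posrE ?exprn_gt0 ?powR_gt0.
  by rewrite lnXn // ln_powR -[ln _ *+ _]mulr_natl ler_pM2r //; lra.
have Nk1 : (272 * k.-1 <= N)%N by rewrite -(ler_nat R) natrM; lra.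
have Nk2 : (64 * k.-1 ^ 2 <= N)%N.
  rewrite -(ler_nat R) natrM natrX.
  have : (k.-1)%:R ^+ 2 <= c ^+ 2 by rewrite ler_pXn2r ?nnegrE // ltW.
  by lra.
have sample L : (#|G| <= (N %/ 8) * #|[set b | probes_within S (probe_set k alg b) L]|)%N ->
    eta * N%:R < (size L)%:R :> R.
  move=> /(count_bound_pow2 alg_ok alg_na k_ge3 Nk1 Nk2 G_ge) le_pow.
  have k1_gt0 : (0 < k.-1)%N by case: (k) k_ge3 => [|[]].
  have le_N := le_mul_divn_divn k1_gt0 Nk1.
  rewrite mulrC; apply: (sample_size_gt c_gt0 v_gt0 le_N le_pow s_le le_w).
    by apply: leq_trans N_ge16.
  by lra.
have m_gt0 : (0 < N %/ 8)%N by rewrite divn_gt0 // (leq_trans _ N_ge16).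
rewrite expr1 powRD ?(gt_eqF N_gt0) ?implybT // (powRr1 (ltW N_gt0)).
have root_ge0 : 0 <= (N%:R : R) `^ T%:R^-1 by exact: powR_ge0.
rewrite ler_pdivrMr; last by lra.
have S_ge0 : 0 <= S%:R :> R by [].
(* For [T >= ln N] the root of [N] is at most [4], and the linear bound on [S] from taking all cells
   as [L] suffices. *)
have [le_T|lt_T] := leP (ln (N%:R : R)) T%:R.
  have := root_le4 (ltn_trans _ N_ge16) T_gt0 le_T => /(_ isT) root_le.
  have lt_S : eta * N%:R < S%:R.
    have := sample (iota 0 S); rewrite size_iota; apply.
    rewrite (_ : [set b | _] = setT) ?cardsT ?leq_pmull //; apply/setP => b.
    by rewrite !inE; apply/allP => a _; apply/implyP; rewrite mem_iota.
  have h1 : eta / 64 * (N%:R * N%:R `^ T%:R^-1) <= eta / 64 * (N%:R * 4).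
    by rewrite ler_wpM2l ?ler_wpM2l // ?ltW // divr_gt0.
  have h2 : 0 < eta * N%:R by rewrite mulr_gt0.
  have h3 : S%:R <= S%:R * ln (N%:R : R) by rewrite ler_peMr.
  by apply: (le_trans h1); lra.
(* The largest [K] with [K ^ T <= N / 8] lets the sampled cells serve enough queries and is still at
   least [N ^ (1/T) / 16]. *)
have : exists K, ((0 < K) && (K ^ T <= N %/ 8))%N by exists 1%N; rewrite exp1n.
move=> exK; have ubK K : ((0 < K) && (K ^ T <= N %/ 8) -> K <= N %/ 8)%N.
  by move=> /andP[K_gt0 le]; apply: leq_trans le; rewrite -{1}(expn1 K) leq_pexp2l.
case: (ex_maxnP exK ubK) => K /andP[K_gt0 le_K] max_K.
have lt_K : (N %/ 8 < K.+1 ^ T)%N.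
  by rewrite ltnNge; apply/negP => le; have := max_K K.+1; rewrite le ltnn => /(_ isT).
have root_leK : (N%:R : R) `^ T%:R^-1 <= 16 * K%:R.
  apply: root_le => //; first by rewrite mulr_ge0.
  by rewrite -natrM -natrX ler_nat leq_exp_of_divn_lt.
have [L [size_L le_L]] := cell_sampling S K_gt0 (size_probe_set alg_ok).
have : eta * N%:R < (size L)%:R :> R.
  by apply: sample; apply: (leq_trans le_L); rewrite leq_mul2r le_K orbT.
rewrite size_L natrM -natr1 => lt_S.
have K_pos : 0 < K%:R :> R by rewrite ltr0n.
have div_le : (S %/ K)%:R * K%:R <= S%:R :> R by rewrite -natrM ler_nat leq_trunc_div.
have ln_le : ln (N%:R : R) <= eta * N%:R / 2 by apply: ln_le_linear => //; lra.
have d_ge0 : 0 <= (S %/ K)%:R :> R by [].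
move: ln_ge1 lt_T lt_S K_pos div_le ln_le root_leK root_ge0 d_ge0.
move: N_gt0; move: (N%:R : R) (S%:R : R) ((S %/ K)%:R : R) (K%:R : R) (T%:R : R) (ln _) (_ `^ _).
move=> n S' d K' t l x n_gt0 l_ge1 lt_t lt_S K_pos div_le ln_le x_le x_ge0 d_ge0.
(* The rounding term [T] in the size of [L] is below [ln N], hence absorbed by half of [eta * n]. *)
have h1 : eta * n / 2 < l * d by nra.
have h2 : eta * n / 2 * K' <= l * S'.
  apply: (@le_trans _ _ (l * d * K')); first by rewrite ler_wpM2r // ltW.
  by rewrite -mulrA ler_wpM2l //; lra.
have h3 : eta * n * x <= eta * n * (16 * K') by rewrite ler_wpM2l // mulr_ge0 // ltW.
have h4 : 0 < eta * n * K' by rewrite !mulr_gt0.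
rewrite (_ : eta / 64 * (n * x) = eta * n * x / 64); last by field.
by rewrite [S' * l]mulrC; lra.
Qed.
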